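(* Let $(X,\mathcal{A})$ be a measurable space, let $\mu\colon\mathcal{A}\to[0,\infty]$ be a nonadditive measure, and let $0<q<\infty$. The following assertions are equivalent. (i) $\mu$ is monotone autocontinuous from below. (ii) For any $\{f_n\}_{n\in\mathbb{N}}\subset\mathcal{F}_0^+(X)$ and $f\in\mathcal{F}_0^+(X)$, if $f_n\to f$ $\mu$-almost uniformly, then $\mathrm{Ch}(\mu,f^q)\le\liminf_{n\to\infty}\mathrm{Ch}(\mu,f_n^q)$.
   Context: $X$ is a nonempty set and $\mathcal{A}$ is a $\sigma$-field of subsets of $X$. A nonadditive measure is a set function $\mu\colon\mathcal{A}\to[0,\infty]$ with $\mu(\emptyset)=0$ and $\mu(A)\le\mu(B)$ whenever $A,B\in\mathcal{A}$, $A\subset B$. $\mathcal{F}_0^+(X)$ is the set of all $\mathcal{A}$-measurable functions $X\to[0,\infty)$. Monotone autocontinuous from below: $\mu(A\setminus B_n)\to\mu(A)$ whenever $A,B_n\in\mathcal{A}$, $\{B_n\}_{n\in\mathbb{N}}$ is nonincreasing, and $\mu(B_n)\to 0$. $f_n\to f$ $\mu$-almost uniformly: for any $\varepsilon>0$ there is $E_\varepsilon\in\mathcal{A}$ with $\mu(E_\varepsilon)<\varepsilon$ such that $f_n\to f$ uniformly on $X\setminus E_\varepsilon$. Choquet integral: $\mathrm{Ch}(\mu,f):=\int_0^\infty\mu(\{f>t\})\,dt\in[0,\infty]$ (Lebesgue integral) for $f\in\mathcal{F}_0^+(X)$. *)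

(* Defs.v *)
From mathcomp Require Import all_boot all_order all_algebra.
From mathcomp Require Import all_classical all_reals all_analysis.
Import Order.TTheory GRing.Theory Num.Theory.
Import numFieldNormedType.Exports.

Set Implicit Arguments.
Unset Strict Implicit.
Unset Printing Implicit Defensive.

Local Open Scope classical_set_scope.
Local Open Scope ring_scope.
Local Open Scope ereal_scope.

(* Set functions are total on [set X]; only their values on measurable sets
   are ever constrained or used. *)
Definition nonadditive_measure (d : measure_display) (X : measurableType d)
    (R : realType) (mu : set X -> \bar R) : Prop :=
  [/\ mu set0 = 0,
      forall A : set X, measurable A -> 0 <= mu A &
      forall A B : set X, measurable A -> measurable B ->
        A `<=` B -> mu A <= mu B].

Definition monotone_autocontinuous_below (d : measure_display)
    (X : measurableType d) (R : realType) (mu : set X -> \bar R) : Prop :=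
  forall (A : set X) (B : nat -> set X),
    measurable A -> (forall n : nat, measurable (B n)) ->
    nonincreasing_seq B ->
    mu (B n) @[n --> \oo] --> 0 ->
    mu (A `\` B n) @[n --> \oo] --> mu A.

Definition F0plus (d : measure_display) (X : measurableType d)
    (R : realType) (f : X -> R) : Prop :=
  measurable_fun setT f /\ forall x : X, (0 <= f x)%R.

Definition almost_uniform_cvg (d : measure_display) (X : measurableType d)
    (R : realType) (mu : set X -> \bar R) (f_ : nat -> X -> R) (f : X -> R)
    : Prop :=
  forall eps : R, (0 < eps)%R ->
    exists E : set X, [/\ measurable E, mu E < eps%:E &
      {uniform ~` E, f_ @ \oo --> f}].

Definition Choquet (d : measure_display) (X : measurableType d)
    (R : realType) (mu : set X -> \bar R) (f : X -> R) : \bar R :=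
  \int[@lebesgue_measure R]_(t in `[0%R, +oo[) mu [set x | (t < f x)%R].

(* Main.v *)
(** If f_n -> f almost uniformly, the exceptional sets can be taken to decrease
    to measure 0, and off each of them {f > t} is eventually contained in
    {f_n > s} for s < t.  Autocontinuity then gives G t <= L s for s < t, where
    G and L are the level functions mu {f^q > t} and liminf mu {f_n^q > s}.
    Hence the intervals ]L s, G s[ are pairwise disjoint, {L < G} is countable
    and therefore null, and Fatou's lemma concludes.  Conversely, apply (ii) to
    the indicators of A \ B_n, which equal that of A off B_N for n >= N. *)

Require Import Defs.
From mathcomp Require Import all_boot all_order all_algebra.
From mathcomp Require Import all_classical all_reals all_analysis.
From mathcomp Require Import measurable_realfun.
Import Order.TTheory GRing.Theory Num.Theory.
Import numFieldNormedType.Exports.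

Set Implicit Arguments.
Unset Strict Implicit.
Unset Printing Implicit Defensive.

Local Open Scope classical_set_scope.
Local Open Scope ring_scope.
Local Open Scope ereal_scope.

(** * Monotone level functions, limits inferior and uniform convergence *)

Lemma ereal_rat_between (R : realType) (a b : \bar R) :
  a < b -> exists q : rat, a < (ratr q)%:E < b.
Proof.
have itvoo (x y : R) : (x < y)%R -> exists q : rat, (x < ratr q < y)%R.
  by move=> /rat_in_itvoo[q]; rewrite in_itv/=; exists q.
case: a b => [x| |] [y| |]//=; rewrite ?lte_fin.
- by move=> /itvoo[q qxy]; exists q; rewrite !lte_fin.
- have /itvoo[q /andP[xq _]] : (x < x + 1)%R by rewrite ltrDl.
  by exists q; rewrite lte_fin xq ltry.
- have /itvoo[q /andP[_ qy]] : (y - 1 < y)%R by rewrite ltrBlDr ltrDl.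
  by exists q; rewrite lte_fin qy ltNyr.
- by exists 0%R; rewrite ltNyr ltry.
Qed.

(** Choose a rational [r s] strictly between [F s] and [G s]. For crossing points [s < t], one has
    [r t < G t <= F s < r s], so [r] is injective on the crossing set. *)
Lemma countable_crossing (R : realType) (D : set R) (F G : R -> \bar R) :
  (forall s t, D s -> (s < t)%R -> G t <= F s) ->
  countable [set s | D s /\ F s < G s].
Proof.
move=> GF; set C := [set s | _].
have /choice[r rP] (s : R) : exists r : rat, C s -> F s < (ratr r)%:E < G s.
  have [[_ /ereal_rat_between[r ?]]|nCs] := pselect (C s); first by exists r.
  (* Off [C] the chosen value is arbitrary. *)
  by exists 0%R.
have decr s t : C s -> C t -> (s < t)%R -> (ratr (r t) < ratr (r s) :> R)%R.
  move=> Cs Ct st; have /andP[_ rt] := rP _ Ct; have /andP[rs _] := rP _ Cs.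
  by rewrite -lte_fin (lt_le_trans rt)// (le_trans _ (ltW rs))// GF//; case: Cs.
apply/countable_injP; exists (pickle \o r) => s t /set_mem Cs /set_mem Ct /=.
move=> /(pcan_inj pickleK) rst.
by case: (ltgtP s t) => // /decr; rewrite rst ltxx => /(_ _ _)/notF[].
Qed.

(** The preimage of an upper ray is closed downwards, hence an interval, and such rays generate the
    Borel sets of the extended line. *)
Lemma nonincreasing_emeasurable (R : realType) (D : set R) (f : R -> \bar R) :
  measurable D -> {homo f : x y / (x <= y)%R >-> y <= x} -> measurable_fun D f.
Proof.
move=> mD f_ni; apply: measurable_funTS => _.
apply: (measurability _ (ErealGenOInfty.measurableE R)) => // _ [_ [r ->] <-].
rewrite setTI; apply: is_interval_measurable => x y /=.
rewrite !in_itv/= !andbT => _ fy z /andP[_ zy].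
by rewrite in_itv/= andbT (lt_le_trans fy)// f_ni.
Qed.

Lemma le_limn_einf (R : realType) (c : \bar R) (u : (\bar R)^nat) :
  (\forall n \near \oo, c <= u n) -> c <= limn_einf u.
Proof.
move=> [N _ cu]; rewrite limn_einf_lim; apply: lime_ge; first exact: is_cvg_einfs.
exists N => // n /= Nn; apply: le_ereal_inf_tmp => _ [m /= nm <-].
by apply: cu => /=; exact: leq_trans nm.
Qed.

(** The entourages of [R] are generated by the pairs at distance less than [e], so it suffices to
    test those. *)
Lemma uniform_cvg_normP (X : choiceType) (R : realType) (A : set X)
    (f_ : nat -> X -> R) (f : X -> R) :
  {uniform A, f_ @ \oo --> f} <->
  forall e : R, (0 < e)%R ->
    \forall n \near \oo, forall x, A x -> (`|f x - f_ n x| < e)%R.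
Proof.
split=> [ff e e0|ff].
  apply: (ff [set h | forall x, A x -> (`|f x - h x| < e)%R]).
  apply/uniform_nbhs.
  exists [set xy : R * R | ball xy.1 e xy.2]; split => //.
  by rewrite -entourage_ballE; exists e.
move=> P /uniform_nbhs[E [+ EP]]; rewrite -entourage_ballE => -[e /= e0 eE].
have := ff _ e0; apply: filterS => n fn; apply: EP => x Ax.
by apply: eE; exact: fn.
Qed.

Lemma measurable_gt (d : measure_display) (X : measurableType d) (R : realType)
    (f : X -> R) (t : R) :
  measurable_fun setT f -> measurable [set x | (t < f x)%R].
Proof.
move=> mf; rewrite (_ : [set _ | _] = setT `&` f @^-1` `]t, +oo[).
  exact: mf.
by apply/seteqP; split=> x /=; rewrite in_itv/= andbT// => -[].
Qed.

(** On nonnegative reals, the power [q] is strictly increasing with inverse the power [q^-1]. Level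
    sets of powers thus become level sets of the functions themselves, whose convergence is the one
    assumed. *)
Lemma powR_level (T : Type) (R : realType) (q s : R) (f : T -> R) :
  (0 < q)%R -> (0 <= s)%R -> (forall x, 0 <= f x)%R ->
  [set x | (s < f x `^ q)%R] = [set x | (s `^ q^-1 < f x)%R].
Proof.
move=> q0 s0 f0; have q1 : (0 < q^-1)%R by rewrite invr_gt0.
have sE : s = ((s `^ q^-1) `^ q)%R by rewrite -powRrM mulVf ?gt_eqF// powRr1.
have fE x : f x = ((f x `^ q) `^ q^-1)%R.
  by rewrite -powRrM mulfV ?gt_eqF// powRr1.
apply/seteqP; split => x /= h.
  by rewrite fE gt0_ltr_powR// nnegrE// powR_ge0.
by rewrite sE gt0_ltr_powR// nnegrE// powR_ge0.
Qed.

(** * Lower semicontinuity from autocontinuity *)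

Section nonadditive.
Context (d : measure_display) (X : measurableType d) (R : realType).
Variable mu : set X -> \bar R.
Hypothesis hmu : nonadditive_measure mu.

Lemma almost_uniform_nonincreasing (f_ : nat -> X -> R) (f : X -> R) :
  almost_uniform_cvg mu f_ f ->
  exists B : nat -> set X, [/\ forall n, measurable (B n),
    nonincreasing_seq B, mu (B n) @[n --> \oo] --> 0 &
    forall n, {uniform ~` B n, f_ @ \oo --> f}].
Proof.
case: hmu => mu0 mu_ge0 mu_le fau.
have /choice[E EP] (n : nat) : exists E, [/\ measurable E,
    mu E < (n.+1%:R^-1 : R)%:E & {uniform ~` E, f_ @ \oo --> f}].
  by apply: fau; rewrite invr_gt0.
(* Finite intersections decrease, and monotonicity alone gives [mu (B n) <= mu (E n)], which is
   below [n.+1%:R^-1]. *)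
pose B n := \bigcap_(k < n.+1) E k.
have mB n : measurable (B n).
  by apply: bigcap_measurable => [|k _]; [exists 0%N | case: (EP k)].
exists B; split => //.
- move=> m n mn; apply/subsetPset => x Bx k /= km; apply: Bx => /=.
  exact: leq_trans km _.
- apply: (@squeeze_cvge _ _ _ _ (cst 0) _ (EFin \o harmonic)).
  + apply: nearW => n /=; rewrite mu_ge0//=.
    have [mE /ltW muE _] := EP n.
    by rewrite (le_trans _ muE)// mu_le// => x; apply => /=.
  + exact: cvg_cst.
  + exact: cvge_harmonic.
- move=> n; rewrite /B setC_bigcap; elim: n => [|n IH].
    rewrite (_ : \bigcup_(i < 1) ~` E i = ~` E 0%N); first by case: (EP 0%N).
    by rewrite bigcup_mkord big_ord1.
  rewrite (_ : \bigcup_(i < n.+2) ~` E i =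
    (\bigcup_(i < n.+1) ~` E i) `|` ~` E n.+1).
    by apply: cvg_uniformU => //; case: (EP n.+1).
  by rewrite !bigcup_mkord big_ord_recr.
Qed.

Lemma le_level_limn_einf (f_ : nat -> X -> R) (f : X -> R) (s t : R) :
  monotone_autocontinuous_below mu ->
  (forall n, measurable_fun setT (f_ n)) -> measurable_fun setT f ->
  almost_uniform_cvg mu f_ f -> (s < t)%R ->
  mu [set x | (t < f x)%R] <= limn_einf (fun n => mu [set x | (s < f_ n x)%R]).
Proof.
case: hmu => mu0 mu_ge0 mu_le mac mf_ mf.
move=> /almost_uniform_nonincreasing[B [mB B_ni muB0 Bunif]] st.
have mt := measurable_gt t mf.
(* By autocontinuity, it is enough to bound the measure of [{f > t}] minus [B n] for each fixed [n];
   the limit inferior runs over a separate index [m]. *)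
apply: (cvge_to_le (mac _ _ mt mB B_ni muB0)); apply: nearW => n.
apply: le_limn_einf.
have /uniform_cvg_normP/(_ (t - s)%R) := Bunif n.
rewrite subr_gt0 => /(_ st); apply: filterS => m fm.
apply: mu_le; [exact: measurableD|exact: measurable_gt|].
(* Off [B n], [f_ m x > f x - (t - s) > s]. *)
move=> x [/= tf nBx]; have := fm _ nBx.
rewrite ltr_distlC => /andP[+ _]; apply: le_lt_trans.
by rewrite opprB addrC -addrA lerDl addrC subr_ge0 ltW.
Qed.

Lemma measurable_level (f : X -> R) (D : set R) : measurable_fun setT f ->
  measurable D -> measurable_fun D (fun t => mu [set x | (t < f x)%R]).
Proof.
case: hmu => mu0 mu_ge0 mu_le mf mD.
apply: nonincreasing_emeasurable => // s t st; apply: mu_le.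
- exact: measurable_gt.
- exact: measurable_gt.
- by move=> x /=; exact: le_lt_trans.
Qed.

Lemma Choquet_le_limn_einf (q : R) (f_ : nat -> X -> R) (f : X -> R) :
  (0 < q)%R -> monotone_autocontinuous_below mu ->
  (forall n, F0plus (f_ n)) -> F0plus f -> almost_uniform_cvg mu f_ f ->
  Choquet mu (fun x => f x `^ q)%R <=
  limn_einf (fun n => Choquet mu (fun x => f_ n x `^ q)%R).
Proof.
case: (hmu) => mu0 mu_ge0 mu_le q0 mac hf_ [mf f0] fau.
have mpow (g : X -> R) : measurable_fun setT g ->
    measurable_fun setT (fun x => g x `^ q)%R.
  by move=> mg; exact: (measurableT_comp (measurable_powR q)).
have mD : measurable (`[0%R, +oo[ : set R) by exact: measurable_itv.
pose G s := mu [set x | (s < f x `^ q)%R].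
pose L s := limn_einf (fun n => mu [set x | (s < f_ n x `^ q)%R]).
have GL s t : `[0%R, +oo[%classic s -> (s < t)%R -> G t <= L s.
  rewrite /= in_itv/= andbT => s0 st; rewrite /G /L.
  rewrite (powR_level (f := f))// ?(le_trans s0 (ltW st))//.
  rewrite [X in limn_einf X](_ : _ =
      fun n => mu [set x | (s `^ q^-1 < f_ n x)%R]); last first.
    by apply/funext => n; rewrite (powR_level (f := f_ n))//; case: (hf_ n).
  apply: le_level_limn_einf => //; first by move=> n; case: (hf_ n).
  by rewrite gt0_ltr_powR ?invr_gt0 ?nnegrE// (le_trans s0 (ltW st)).
have m_n n : measurable_fun (`[0%R, +oo[ : set R)
    (fun s => mu [set x | (s < f_ n x `^ q)%R]).
  by apply: measurable_level => //; apply: mpow; case: (hf_ n).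
(* The integral of [L] is the middle term: Fatou bounds it from above, and the almost everywhere
   inequality [G <= L] bounds it from below. *)
apply: (@le_trans _ _
  (\int[@lebesgue_measure R]_(s in `[0%R, +oo[) L s)); last first.
  apply: fatou => // n s _; apply: mu_ge0; apply: measurable_gt; apply: mpow.
  by case: (hf_ n).
apply: ae_ge0_le_integral => //.
- by move=> s _; apply: mu_ge0; apply: measurable_gt; exact: mpow.
- by apply: measurable_level => //; exact: mpow.
- move=> s _; apply: le_limn_einf; apply: nearW => n.
  by apply: mu_ge0; apply: measurable_gt; apply: mpow; case: (hf_ n).
(* The limit inferior is the negated limit superior of the negated sequence. *)
- rewrite /L /limn_einf; apply: measurableT_comp => //.
  apply: measurable_fun_limn_esup => n; apply: (measurableT_comp _ (m_n n)).
  exact: oppe_measurable.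
- have cC := @countable_crossing _ _ _ _ GL.
  exists [set s | `[0%R, +oo[%classic s /\ L s < G s]; split.
  + exact: countable_measurable.
  + exact: countable_lebesgue_measure0.
  + by move=> s /= /not_implyP[Ds /negP]; rewrite -ltNge.
Qed.

(** * Autocontinuity from indicator functions *)

Lemma Choquet_powR_indic (q : R) (A : set X) : (0 < q)%R -> measurable A ->
  Choquet mu (fun x => \1_A x `^ q)%R = mu A.
Proof.
case: hmu => mu0 mu_ge0 mu_le q0 mA; rewrite /Choquet.
(* The level set of the indicator is [A] for [0 <= t < 1] and empty for [t >= 1]; since [q > 0], the
   power leaves the values 0 and 1 unchanged. *)
transitivity (\int[@lebesgue_measure R]_(t in `[0%R, +oo[)
    (((cst (mu A) : R -> \bar R) \_ `[0%R, 1%R[) t)).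
  apply: eq_integral => t; rewrite inE/= in_itv/= andbT => t0; rewrite patchE/=.
  have pE x : (\1_A x `^ q = \1_A x :> R)%R.
    by rewrite indicE; case: (_ \in _); rewrite ?powR1// powR0// gt_eqF.
  have [|] := ltP t 1%R => t1.
    rewrite mem_set/= ?in_itv/= ?t0//; congr (mu _).
    apply/seteqP; split => x /=; rewrite pE indicE.
      by case: (boolP (x \in A)) => [/set_mem//|_]; rewrite ltNge t0.
    by move=> Ax; rewrite mem_set.
  rewrite memNset/=; last by rewrite in_itv/= t0 ltNge t1.
  transitivity (mu set0); last by rewrite mu0.
  congr (mu _).
  apply/seteqP; split => x //=; rewrite pE indicE ltNge (le_trans _ t1)//.
  by case: (_ \in _).
rewrite -integral_mkcondr (_ : _ `&` _ = [set` `[0%R, 1%R[]); last first.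
  apply/seteqP; split => t /=; rewrite !in_itv/=; first by case.
  by move=> /andP[-> ->].
rewrite integral_cst//= lebesgue_measure_itv/= lte_fin ltr01 oppr0 adde0.
by rewrite mule1.
Qed.

Lemma monotone_autocontinuous_below_of_Choquet (q : R) : (0 < q)%R ->
  (forall (f_ : nat -> X -> R) (f : X -> R),
     (forall n : nat, F0plus (f_ n)) -> F0plus f ->
     almost_uniform_cvg mu f_ f ->
     Choquet mu (fun x => f x `^ q)%R <=
     limn_einf (fun n => Choquet mu (fun x => f_ n x `^ q)%R)) ->
  monotone_autocontinuous_below mu.
Proof.
case: (hmu) => mu0 mu_ge0 mu_le q0 hCh A B mA mB B_ni muB0.
have mAB n : measurable (A `\` B n) by exact: measurableD.
have F0_indic C : measurable C -> F0plus (\1_C : X -> R).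
  by move=> mC; split=> [|x]; [exact: measurable_indic|rewrite indicE].
have fau : almost_uniform_cvg mu (fun n => \1_(A `\` B n) : X -> R) \1_A.
  move=> e e0.
  have : \forall n \near \oo, mu (B n) < e%:E.
    apply: (muB0 [set y | y < e%:E]); apply: open_nbhs_nbhs.
    by split; [exact: open_ereal_lt_ereal|rewrite /= lte_fin].
  move=> [N _ /(_ N (leqnn N)) muBN]; exists (B N); split => //.
  apply/uniform_cvg_normP => r r0; exists N => // n /= Nn x nBx.
  suff -> : \1_(A `\` B n) x = \1_A x :> R by rewrite subrr normr0.
  have nBnx : ~ B n x by move: (B_ni _ _ Nn) => /subsetPset BnN /BnN.
  rewrite !indicE; congr ((nat_of_bool _)%:R); apply/idP/idP; rewrite !inE.
    by case.
  by split.
have := hCh _ _ (fun n => F0_indic _ (mAB n)) (F0_indic _ mA) fau.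
rewrite Choquet_powR_indic// [X in limn_einf X](_ : _ =
    fun n => mu (A `\` B n)); last first.
  by apply/funext => n; rewrite Choquet_powR_indic.
(* After negation, the limit superior is at most [- mu A], while by monotonicity every term is at
   least [- mu A]; this forces convergence. *)
rewrite /limn_einf leeNr => le_mu; apply/cvgeNP; apply: limn_esup_le_cvg => // n.
by rewrite leeN2 mu_le// => x [].
Qed.

End nonadditive.

Theorem proposition6p5 (R : realType) (d : measure_display)
    (X : measurableType d) (mu : set X -> \bar R)
    (hmu : nonadditive_measure mu) (q : R) (hq : (0 < q)%R) :
  monotone_autocontinuous_below mu <->
  (forall (f_ : nat -> X -> R) (f : X -> R),
     (forall n : nat, F0plus (f_ n)) -> F0plus f ->
     almost_uniform_cvg mu f_ f ->
     Choquet mu (fun x => f x `^ q)%R <=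
     limn_einf (fun n => Choquet mu (fun x => f_ n x `^ q)%R)).
Proof.
split=> [mac f_ f hf_ hf fau|].
  exact: Choquet_le_limn_einf.
exact: monotone_autocontinuous_below_of_Choquet.
Qed.
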